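(* Let $\phi_t\in\mathcal{L}(V_t)$ ($t=1,\dots,\ell$) and $\psi_j\in\mathcal{L}(W_j)$ ($j=0,\dots,s-1$) be a solution of the linearized problem, and let \[ \boldsymbol{u}=\big((\phi_1)_{V_1}|\dots|(\phi_\ell)_{V_\ell}|(\psi_0)_{W_0}|\dots|(\psi_{s-1})_{W_{s-1}}\big)\in\mathbb{F}^\nu . \] Let $\boldsymbol{U}$ be the matrix obtained by stacking $\boldsymbol{K}_1\boldsymbol{U}_1,\dots,\boldsymbol{K}_\ell\boldsymbol{U}_\ell$ vertically, \[ \boldsymbol{U}=\begin{bmatrix}\boldsymbol{K}_1\boldsymbol{U}_1\\ \vdots\\ \boldsymbol{K}_\ell\boldsymbol{U}_\ell\end{bmatrix}, \] where $\boldsymbol{K}_t=1_{Q_t,Q_t}$ if $1\leq t\leq s-1$, and $\boldsymbol{K}_t$ is a left kernel matrix of $1_{Q_t,Q_t-sD}$ if $s\leq t\leq\ell$. Then \[ \boldsymbol{U}\boldsymbol{u}=\boldsymbol{0}. \]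
   Context: Let $F$ be an algebraic function field of genus $g$ over a base field $\mathbb{F}$, and let $P_1,\dots,P_n,P_\infty$ be pairwise distinct rational places of $F$. Let $D=P_1+\cdots+P_n$ and let $G$ be a divisor with $\operatorname{supp}G\cap\operatorname{supp}D=\emptyset$. For a divisor $A$, $\mathcal{L}(A)=\{h\in F\setminus\{0\} : (h)\geq -A\}\cup\{0\}$ and $\mathfrak{l}(A)=\dim_{\mathbb{F}}\mathcal{L}(A)$. Fix integers $1\le s\leq\ell$ and $\lambda_s\geq0$, a received word $\boldsymbol{r}=(r_1,\dots,r_n)\in\mathbb{F}^n$ and an $\boldsymbol{r}$-interpolator $R$ of degree $\rho\geq0$, i.e. $R\in\mathcal{L}(G+\rho P_\infty)$, $R\notin\mathcal{L}(G+(\rho-1)P_\infty)$ and $R(P_i)=r_i$ for all $i$. Put $V_t=\lambda_sP_\infty+tG$ and $Q_t=\lambda_sP_\infty+t(G+\rho P_\infty)$ for $t=1,\dots,\ell$, and $W_j=\lambda_sP_\infty+j(G+\rho P_\infty-D)$ for $j=0,\dots,s-1$. A solution of the linearized problem consists of $\phi_t\in\mathcal{L}(V_t)$ for $t=1,\dots,\ell$ and $\psi_j\in\mathcal{L}(W_j)$ for $j=0,\dots,s-1$, not all zero, such that for every $t=1,\dots,\ell$ the element $\phi_t-\sum_{j=0}^{\min\{t,s-1\}}\binom{t}{j}\psi_jR^{t-j}$ is $0$ if $1\leq t\leq s-1$, and lies in $\mathcal{L}(Q_t-sD)$ if $s\leq t\leq\ell$. Notation: for each divisor $A$, $\boldsymbol{\beta}_A\in\mathcal{L}(A)^{\mathfrak{l}(A)}$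 is a row vector whose entries form a fixed $\mathbb{F}$-basis of $\mathcal{L}(A)$, chosen so that $\mathcal{L}(A)=\mathcal{L}(B)$ if and only if $\boldsymbol{\beta}_A=\boldsymbol{\beta}_B$. For $h\in\mathcal{L}(A)$, $h_A\in\mathbb{F}^{\mathfrak{l}(A)}$ is the unique (column) vector with $\boldsymbol{\beta}_A\cdot h_A=h$. For $p\in\mathcal{L}(B-A)$, $p_{B,A}\in\mathbb{F}^{\mathfrak{l}(B)\times\mathfrak{l}(A)}$ is the matrix whose $i$-th column is $(pa_i)_B$, where $(a_1,\dots,a_{\mathfrak{l}(A)})=\boldsymbol{\beta}_A$. A left kernel matrix of a matrix $M$ is a matrix whose rows form a basis of $\{x : xM=0\}$. Put $\nu=\sum_{r=1}^{\ell}\mathfrak{l}(V_r)+\sum_{j=0}^{s-1}\mathfrak{l}(W_j)$. For $t=1,\dots,\ell$, $\boldsymbol{U}_t\in\mathbb{F}^{\mathfrak{l}(Q_t)\times\nu}$ is the block matrix $[\boldsymbol{V}_{t,1}|\cdots|\boldsymbol{V}_{t,\ell}|\boldsymbol{W}_{t,0}|\cdots|\boldsymbol{W}_{t,s-1}]$, where $\boldsymbol{V}_{t,r}=1_{Q_t,V_r}$ if $t=r$ and $\boldsymbol{V}_{t,r}=0_{Q_t,V_r}$ if $t\ne r$, and $\boldsymbol{W}_{t,j}=-\binom{t}{j}(R^{t-j})_{Q_t,W_j}$ if $j\leq t$ and $\boldsymbol{W}_{t,j}=0_{Q_t,W_j}$ if $j>t$. *)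

(* Defs.v *)
From HB Require Import structures.
From mathcomp Require Import all_boot all_order all_algebra.
From mathcomp Require Import boolp classical_sets.
From mathcomp.multinomials Require Export freeg.

Set Implicit Arguments.
Unset Strict Implicit.
Unset Printing Implicit Defensive.

Import Order.TTheory GRing.Theory Num.Theory.

Local Open Scope ring_scope.

(* A field extension F of the base field k is given by a morphism
   iota : k -> F. *)

Definition in_ratfunc (k F : fieldType) (iota : {rmorphism k -> F}) (x z : F) :
    Prop :=
  exists p q : {poly k},
    (map_poly iota q).[x] != 0 /\
    z = (map_poly iota p).[x] / (map_poly iota q).[x].

(* F is finite over k(x) for some x transcendental over k. *)
Definition function_field (k F : fieldType) (iota : {rmorphism k -> F}) : Prop :=
  exists x : F, ~ algebraicOver iota x /\
  exists (m : nat) (b : 'I_m -> F), forall y : F,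
  exists c : 'I_m -> F,
    (forall i, in_ratfunc iota x (c i)) /\ y = \sum_(i < m) c i * b i.

(* A place is represented by its normalized discrete valuation v, which is
   trivial on k. The value at 0 (mathematically +oo) is the dummy value 0 and
   must never be used; fixing it makes two places equal as soon as their
   valuations agree on F \ {0}. *)
Record place (k F : fieldType) (iota : {rmorphism k -> F}) := Place {
  val_at :> F -> int;
  val_at0 : val_at 0 = 0;
  val_atM : forall x y, x != 0 -> y != 0 ->
    val_at (x * y) = val_at x + val_at y;
  val_atD : forall x y, x != 0 -> y != 0 -> x + y != 0 ->
    Num.min (val_at x) (val_at y) <= val_at (x + y);
  val_at_const : forall c : k, c != 0 -> val_at (iota c) = 0;
  val_at_normalized : exists2 x : F, x != 0 & val_at x = 1
}.

HB.instance Definition _ (k F : fieldType) (iota : {rmorphism k -> F}) :=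
  gen_eqMixin (place iota).
HB.instance Definition _ (k F : fieldType) (iota : {rmorphism k -> F}) :=
  gen_choiceMixin (place iota).

Definition divisor (k F : fieldType) (iota : {rmorphism k -> F}) : zmodType :=
  {freeg (place iota) / int}.

Section FunctionField.
Context (k F : fieldType) (iota : {rmorphism k -> F}).
Implicit Types (P : place iota) (A B : divisor iota) (S N : set F).

Definition valuation_ring P : set F :=
  [set x | x = 0 \/ 0 <= P x].

Definition maximal_ideal P : set F :=
  [set x | x = 0 \/ 0 < P x].

Definition lincomb (m : nat) (b : 'rV[F]_m) (c : 'cV[k]_m) : F :=
  (b *m map_mx iota c) 0 0.

(* The entries of b represent a k-basis of the quotient S / N of k-subspaces
   N <= S of F; for N = {0} this is a k-basis of S. *)
Definition is_basis S N (m : nat) (b : 'rV[F]_m) : Prop :=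
  (forall i, S (b 0 i)) /\
  (forall x, S x -> exists! c : 'cV[k]_m, N (x - lincomb b c)).

(* The k-dimension of S / N; 0 if it is infinite. *)
Definition quot_dim S N : nat :=
  xget 0%N [set m | exists b : 'rV[F]_m, is_basis S N b].

Definition place_degree P : nat :=
  quot_dim (valuation_ring P) (maximal_ideal P).

Definition rational_place P : Prop := place_degree P = 1%N.

(* h is defined at P, and its residue class is the constant c. *)
Definition value_at P (h : F) (c : k) : Prop := maximal_ideal P (h - iota c).

(* The condition (h) >= - A is read coefficientwise. *)
Definition RRspace A : set F :=
  [set h | h = 0 \/ forall P, - coeff P A <= P h].

Definition ell A : nat := quot_dim (RRspace A) [set 0].

Definition divisor_degree A : int :=
  \sum_(P <- dom A) coeff P A * (place_degree P)%:Z.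

Definition is_genus (g : nat) : Prop :=
  (exists A, divisor_degree A - (ell A)%:Z + 1 = g%:Z) /\
  (forall A, divisor_degree A - (ell A)%:Z + 1 <= g%:Z).

(* A row vector beta_A for each divisor A, with entries a basis of L(A), chosen
   so that beta_A and beta_B agree exactly when L(A) = L(B). As the lengths
   ell A and ell B are only propositionally equal, the rows are compared
   together with their lengths. *)
Definition basis_choice (beta : forall A, 'rV[F]_(ell A)) : Prop :=
  (forall A, is_basis (RRspace A) [set 0] (beta A)) /\
  (forall A B, RRspace A = RRspace B <->
     existT (fun m => 'rV[F]_m) (ell A) (beta A) =
     existT (fun m => 'rV[F]_m) (ell B) (beta B)).

Section Coordinates.
Variable beta : forall A, 'rV[F]_(ell A).

(* h_A; only meaningful for h in L(A). *)
Definition coords A (h : F) : 'cV[k]_(ell A) :=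
  xget 0 [set c | lincomb (beta A) c = h].

(* p_{B,A}; only meaningful for p in L(B - A). *)
Definition mult_mx B A (p : F) : 'M[k]_(ell B, ell A) :=
  \matrix_(i, j) coords B (p * beta A 0 j) i 0.

(* Families indexed by 1, ..., l are functions on nat, used at t.+1 for
   t : 'I_l. *)
Variables (V Q W : nat -> divisor iota) (s l : nat) (R : F).

Definition Vblock (t r : nat) : 'M[k]_(ell (Q t), ell (V r)) :=
  if t == r then mult_mx (Q t) (V r) 1 else mult_mx (Q t) (V r) 0.

Definition Wblock (t j : nat) : 'M[k]_(ell (Q t), ell (W j)) :=
  if (j <= t)%N then - ('C(t, j)%:R *: mult_mx (Q t) (W j) (R ^+ (t - j)))
  else mult_mx (Q t) (W j) 0.

Definition Umx (t : nat) :
    'M[k]_(ell (Q t), \sum_(r < l) ell (V r.+1) + \sum_(j < s) ell (W j)) :=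
  row_mx (\mxrow_(r < l) Vblock t r.+1) (\mxrow_(j < s) Wblock t j).

Definition solution_vec (phi psi : nat -> F) :
    'cV[k]_(\sum_(r < l) ell (V r.+1) + \sum_(j < s) ell (W j)) :=
  col_mx (\mxcol_(r < l) coords (V r.+1) (phi r.+1))
         (\mxcol_(j < s) coords (W j) (psi j)).

(* K t comes with its number of rows. *)
Definition stacked_mx (K : forall t, {m : nat & 'M[k]_(m, ell (Q t))}) :
    'M[k]_(\sum_(t < l) tag (K t.+1),
           \sum_(r < l) ell (V r.+1) + \sum_(j < s) ell (W j)) :=
  \mxcol_(t < l) (tagged (K t.+1) *m Umx t.+1).

End Coordinates.

Definition is_interpolator (n : nat) (P : 'I_n -> place iota)
    (Pinf : place iota) (G : divisor iota) (r : 'rV[k]_n) (R : F) (rho : nat) :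
    Prop :=
  [/\ RRspace (G + << rho%:Z *g Pinf >>) R,
      ~ RRspace (G + << rho%:Z - 1 *g Pinf >>) R
    & forall i, value_at (P i) R (r 0 i)].

Definition linearized_solution (V Q W : nat -> divisor iota) (D : divisor iota)
    (s l : nat) (R : F) (phi psi : nat -> F) : Prop :=
  let err t := phi t -
    \sum_(0 <= j < (minn t s.-1).+1) 'C(t, j)%:R * psi j * R ^+ (t - j) in
  [/\ forall t, (1 <= t <= l)%N -> RRspace (V t) (phi t),
      forall j, (j < s)%N -> RRspace (W j) (psi j),
      (exists2 t, (1 <= t <= l)%N & phi t != 0) \/
      (exists2 j, (j < s)%N & psi j != 0),
      forall t, (1 <= t <= s.-1)%N -> err t = 0
    & forall t, (s <= t <= l)%N -> RRspace (Q t - D *+ s) (err t)].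

End FunctionField.

Definition is_left_kernel_mx (k : fieldType) (m p q : nat)
    (K : 'M[k]_(q, m)) (M : 'M[k]_(m, p)) : Prop :=
  row_free K /\ (forall x : 'rV[k]_m, x *m M = 0 <-> (x <= K)%MS).

(* Main.v *)
Require Import Defs.
From mathcomp Require Import all_boot all_order all_algebra.
From mathcomp Require Import boolp classical_sets.

Set Implicit Arguments.
Unset Strict Implicit.
Unset Printing Implicit Defensive.

Import Order.TTheory GRing.Theory Num.Theory.

Local Open Scope ring_scope.

(** Left multiplication by [beta (Q t)] is injective and sends [Umx t *m u] to
    the error [phi t - \sum_j 'C(t, j) psi j R ^+ (t - j)], once every block is
    seen to map into [L(Q t)]: [R ^+ (t - j)] takes [L(W j)] into
    [L(Q t - j D)], and [D] is effective. The error is [0] for [t < s]; for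
    [t >= s] it lies in [L(Q t - s D)], so that [Umx t *m u] is in the column
    space of the matrix whose left kernel is spanned by the rows of [K t]. *)

Section RiemannRochSpaces.
Context (k F : fieldType) (iota : {rmorphism k -> F}).
Implicit Types (P : place iota) (A B C : divisor iota).

Lemma RRspace0 A : RRspace A 0.
Proof. by left. Qed.

Lemma val_at1 P : P 1 = 0.
Proof. by rewrite -(rmorph1 iota) val_at_const ?oner_neq0. Qed.

Lemma RRspace_1 : RRspace (0 : divisor iota) 1.
Proof. by right=> P; rewrite coeff0 oppr0 val_at1. Qed.

Lemma RRspaceS A B x :
  (forall P, coeff P A <= coeff P B) -> RRspace A x -> RRspace B x.
Proof.
move=> leAB [->|Ax]; first exact: RRspace0.
by right=> P; apply: le_trans (Ax P); rewrite lerN2.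
Qed.

Lemma RRspaceM A B x y :
  RRspace A x -> RRspace B y -> RRspace (A + B) (x * y).
Proof.
(* The value of a place at 0 is a dummy, so additivity of valuations is usable only once zero
   factors are split off. *)
have [->|x0] := eqVneq x 0; first by rewrite mul0r => _ _; exact: RRspace0.
have [->|y0] := eqVneq y 0; first by rewrite mulr0 => _ _; exact: RRspace0.
case=> [x_eq0|Ax]; first by rewrite x_eq0 eqxx in x0.
case=> [y_eq0|By]; first by rewrite y_eq0 eqxx in y0.
by right=> P; rewrite coeffD opprD val_atM // lerD.
Qed.

Lemma RRspaceX A x n : RRspace A x -> RRspace (A *+ n) (x ^+ n).
Proof.
move=> Ax; elim: n => [|n IHn]; first exact: RRspace_1.
by rewrite exprS mulrS; exact: RRspaceM.
Qed.

End RiemannRochSpaces.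

Section Coordinates.
Context (k F : fieldType) (iota : {rmorphism k -> F}).
Implicit Types (A B : divisor iota).

Lemma lincomb0 m (b : 'rV[F]_m) : lincomb iota b 0 = 0.
Proof. by rewrite /lincomb map_mx0 mulmx0 mxE. Qed.

Lemma lincombD m (b : 'rV[F]_m) c d :
  lincomb iota b (c + d) = lincomb iota b c + lincomb iota b d.
Proof. by rewrite /lincomb map_mxD mulmxDr mxE. Qed.

Lemma lincombN m (b : 'rV[F]_m) c : lincomb iota b (- c) = - lincomb iota b c.
Proof. by rewrite /lincomb map_mxN mulmxN mxE. Qed.

Lemma lincombZ m (b : 'rV[F]_m) a c :
  lincomb iota b (a *: c) = iota a * lincomb iota b c.
Proof. by rewrite /lincomb map_mxZ -scalemxAr mxE. Qed.

Lemma lincomb_sum m (b : 'rV[F]_m) n (c : 'I_n -> 'cV[k]_m) :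
  lincomb iota b (\sum_i c i) = \sum_i lincomb iota b (c i).
Proof. by rewrite /lincomb raddf_sum mulmx_sumr summxE. Qed.

Context (beta : forall A, 'rV[F]_(ell A)).
Hypothesis beta_basis : forall A, is_basis iota (RRspace A) [set 0]%classic (beta A).

(** Uniqueness of the coordinates of 0 is enough: both [c - d] and the zero vector represent it. *)
Lemma lincomb_inj A : injective (lincomb iota (beta A)).
Proof.
move=> c d eq_cd; apply: subr0_eq.
have [_ /(_ 0 (RRspace0 A))[e [_ uniq_e]]] := beta_basis A.
rewrite -(uniq_e (c - d)); last by rewrite /= lincombD lincombN eq_cd !subrr.
by apply: uniq_e; rewrite /= lincomb0 subrr.
Qed.

Lemma coordsK A h : RRspace A h -> lincomb iota (beta A) (coords beta A h) = h.
Proof.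
move=> Ah; apply: (@xgetPex _ 0 [set c | lincomb iota (beta A) c = h]%classic).
have [_ /(_ h Ah)[c [/subr0_eq-> _]]] := beta_basis A.
by exists c.
Qed.

(** Both sides are linear in [c], and column j holds the coordinates of [p * beta A 0 j]. The
    hypothesis asks only that multiplication by [p] map L(A) into L(B), which covers zero blocks and
    inclusions ([p = 1]) alike. *)
Lemma lincomb_mult_mx A B p c :
  (forall a, RRspace A a -> RRspace B (p * a)) ->
  lincomb iota (beta B) (mult_mx beta B A p *m c) =
  p * lincomb iota (beta A) c.
Proof.
move=> pAB; rewrite /lincomb map_mxM mulmxA !mxE big_distrr /=.
apply: eq_bigr => j _; rewrite mulrA; congr (_ * _).
have [/(_ j)/pAB/coordsK<- _] := beta_basis A.
by rewrite /lincomb !mxE; apply: eq_bigr => i _; rewrite !mxE.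
Qed.

Lemma lincomb_mult_mx_coords A B p h :
  (forall a, RRspace A a -> RRspace B (p * a)) -> RRspace A h ->
  lincomb iota (beta B) (mult_mx beta B A p *m coords beta A h) = p * h.
Proof. by move=> pAB Ah; rewrite lincomb_mult_mx// coordsK. Qed.

Lemma lincomb_Umx (V Q W : nat -> divisor iota) (s l : nat) (R : F)
    (phi psi : nat -> F) t :
  (0 < t <= l)%N ->
  (forall a, RRspace (V t) a -> RRspace (Q t) a) ->
  (forall j a, (j <= t)%N -> RRspace (W j) a -> RRspace (Q t) (R ^+ (t - j) * a)) ->
  (forall r, (0 < r <= l)%N -> RRspace (V r) (phi r)) ->
  (forall j, (j < s)%N -> RRspace (W j) (psi j)) ->
  lincomb iota (beta (Q t))
    (Umx beta V Q W s l R t *m solution_vec beta V W s l phi psi) =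
  phi t - \sum_(j < s | (j <= t)%N) 'C(t, j)%:R * psi j * R ^+ (t - j).
Proof.
move=> /andP[t0 tl] VQ WQ Vphi Wpsi.
rewrite /Umx /solution_vec mul_row_col !mul_mxrow_mxcol lincombD !lincomb_sum.
(* Zero blocks are multiplication by 0, which maps every L(A) into L(Q t). *)
have zeroQ A a : RRspace A a -> RRspace (Q t) (0 * a).
  by rewrite mul0r => _; exact: RRspace0.
congr (_ + _).
  (* Block r of the row is numbered [r.+1], so the only nonzero V-block sits at index [t.-1]. *)
  have tl' : (t.-1 < l)%N by rewrite prednK.
  rewrite (bigD1 (Ordinal tl')) //= big1 ?addr0 => [|r ne_rt]; last first.
    rewrite /Vblock ifN; last first.
      by apply: contraNneq ne_rt => tr; apply/eqP/val_inj; rewrite /= tr.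
    by rewrite (lincomb_mult_mx_coords (@zeroQ _)) ?mul0r//; apply: Vphi; exact: ltn_ord.
  rewrite /Vblock prednK// eqxx lincomb_mult_mx_coords ?mul1r// => [a|].
    by rewrite mul1r; exact: VQ.
  by apply: Vphi; rewrite t0.
(* The condition j <= t becomes a zero summand for j > t, matching the zero W-blocks. *)
rewrite -sumrN [RHS]big_mkcond /=; apply: eq_bigr => j _; rewrite /Wblock.
case: leqP => [jt|tj]; last first.
  by rewrite (lincomb_mult_mx_coords (@zeroQ _)) ?mul0r//; apply: Wpsi.
rewrite mulNmx -scalemxAl lincombN lincombZ rmorph_nat.
rewrite lincomb_mult_mx_coords; first by rewrite -mulrA [psi j * _]mulrC.
  by move=> a; exact: WQ.
exact: Wpsi.
Qed.

(** The matrix of the inclusion of L(A) in L(B) turns coordinates in [beta A] into coordinates in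
    [beta B], so [c] lies in its column space, which [K] annihilates row by row. *)
Lemma left_kernel_mul_coords A B q (K : 'M[k]_(q, ell B)) (c : 'cV_(ell B)) :
  (forall a, RRspace A a -> RRspace B a) ->
  is_left_kernel_mx K (mult_mx beta B A 1) ->
  RRspace A (lincomb iota (beta B) c) -> K *m c = 0.
Proof.
move=> AB [_ kerK] Ac.
have -> : c = mult_mx beta B A 1 *m coords beta A (lincomb iota (beta B) c).
  apply: lincomb_inj; rewrite lincomb_mult_mx_coords ?mul1r// => a.
  by rewrite mul1r; exact: AB.
rewrite mulmxA; suff -> : K *m mult_mx beta B A 1 = 0 by rewrite mul0mx.
by apply/row_matrixP => i; rewrite row_mul row0; apply/kerK/row_sub.
Qed.

End Coordinates.

Theorem mainTheorem5
    (k F : fieldType) (iota : {rmorphism k -> F}) (g : nat)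
    (hF : function_field iota) (hg : is_genus iota g)
    (n : nat) (P : 'I_n -> place iota) (Pinf : place iota)
    (hP_rat : forall i, rational_place (P i)) (hPinf_rat : rational_place Pinf)
    (hP_inj : injective P) (hP_Pinf : forall i, P i <> Pinf)
    (G : divisor iota)
    (D := \sum_(i < n) << P i >> : divisor iota)
    (hG : forall X : place iota, ~ (X \in dom G /\ X \in dom D))
    (s l lam : nat) (hs : (1 <= s)%N) (hsl : (s <= l)%N)
    (r : 'rV[k]_n) (R : F) (rho : nat)
    (hR : is_interpolator P Pinf G r R rho)
    (V := fun t : nat => << lam%:Z *g Pinf >> + G *+ t : divisor iota)
    (Q := fun t : nat =>
       << lam%:Z *g Pinf >> + (G + << rho%:Z *g Pinf >>) *+ t : divisor iota)
    (W := fun j : nat =>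
       << lam%:Z *g Pinf >> + (G + << rho%:Z *g Pinf >> - D) *+ j : divisor iota)
    (beta : forall A : divisor iota, 'rV[F]_(ell A))
    (hbeta : basis_choice beta)
    (phi psi : nat -> F)
    (hsol : linearized_solution V Q W D s l R phi psi)
    (K : forall t : nat, {m : nat & 'M[k]_(m, ell (Q t))})
    (hK_small : forall t : nat, (1 <= t <= s.-1)%N ->
       K t = existT (fun m => 'M[k]_(m, ell (Q t))) (ell (Q t))
               (mult_mx beta (Q t) (Q t) 1))
    (hK_large : forall t : nat, (s <= t <= l)%N ->
       is_left_kernel_mx (projT2 (K t)) (mult_mx beta (Q t) (Q t - D *+ s) 1)) :
  stacked_mx beta V W s l R K *m solution_vec beta V W s l phi psi = 0.
Proof.
have [beta_basis _] := hbeta.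
have [hphi hpsi _ err0 errQ] := hsol.
have [hRG _ _] := hR.
have D_ge0 X : 0 <= coeff X D.
  rewrite /D raddf_sum sumr_ge0 // => i _.
  by rewrite /= coeffU mul1r ler0n.
have VQ t a : RRspace (V t) a -> RRspace (Q t) a.
  (* The difference of [Q t] and [V t] is t rho [Pinf], which is effective. *)
  apply: RRspaceS => X; rewrite /V /Q mulrnDl !coeffD !coeffMn !lerD2l lerDl.
  by rewrite mulrn_wge0// coeffU mulr_ge0 ?ler0n.
have WQ t j a :
    (j <= t)%N -> RRspace (W j) a -> RRspace (Q t) (R ^+ (t - j) * a).
  (* The divisors add up: (t - j)(G + rho Pinf) + W j = Q t - j D, which is at most Q t. *)
  move=> jt Wa; apply: RRspaceS (RRspaceM (RRspaceX (t - j) hRG) Wa) => X.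
  rewrite /W /Q mulrnBl -[in leRHS](subnK jt) mulrnDr addrCA !coeffD coeffN.
  by rewrite lerD2l lerD2l gerBl coeffMn mulrn_wge0.
have QDQ t a : RRspace (Q t - D *+ s) a -> RRspace (Q t) a.
  by apply: RRspaceS => X; rewrite coeffB gerBl coeffMn mulrn_wge0.
rewrite /stacked_mx mxcol_mul; apply/eqP; rewrite -mxcol0; apply/eqP.
apply: eq_mxcol => t; rewrite -mulmxA.
set c := Umx _ _ _ _ _ _ _ _ *m _.
have tl : (0 < t.+1 <= l)%N by rewrite ltn_ord.
have errE : lincomb iota (beta (Q t.+1)) c = phi t.+1 -
    \sum_(0 <= j < (minn t.+1 s.-1).+1) 'C(t.+1, j)%:R * psi j * R ^+ (t.+1 - j).
  rewrite lincomb_Umx//; [|exact: VQ|by move=> j a; exact: WQ].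
  (* As s >= 1, the inclusive bound min(t+1, s-1) is the strict bound min(t+2, s), that is, j < s
     together with j <= t+1. *)
  congr (_ - _); rewrite big_mkord -minnSS prednK//.
  rewrite (big_ord_widen s (fun j => 'C(t.+1, j)%:R * psi j * R ^+ (t.+1 - j))).
    by apply: eq_bigl => j; rewrite leq_min ltnS ltn_ord andbT.
  exact: geq_minr.
have [ts|st] := ltnP t.+1 s.
  suff -> : c = 0 by rewrite mulmx0.
  apply: (lincomb_inj beta_basis); rewrite errE lincomb0 err0//.
  by move: ts; rewrite -{1}(prednK hs) ltnS.
have tsl : (s <= t.+1 <= l)%N by rewrite st ltn_ord.
rewrite (left_kernel_mul_coords beta_basis (QDQ t.+1) (hK_large _ tsl)) //.
by rewrite errE; exact: errQ.
Qed.
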